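(* There is an absolute constant $C>0$ such that for every $n\ge 2$ and every Boolean function $f:\{0,1\}^n\times\{0,1\}^n\to\{0,1\}$, $$Q^{\parallel}(f)\le C\cdot 2^{8\,Q^{pub}(f)}\log n .$$
   Context: All protocols compute $f$ with error probability at most $1/3$ on every input. $Q^{\parallel}(f)$ is the minimal total number of qubits communicated in a quantum simultaneous-message-passing (SMP) protocol for $f$ with no shared randomness and no shared entanglement: Alice (holding $x$) and Bob (holding $y$) each send one quantum message to a referee who holds no input and outputs the answer. $Q^{pub}(f)$ is the minimal number of qubits communicated in a (multi-round, interactive) two-party quantum protocol between Alice and Bob computing $f$, where Alice and Bob share an unlimited amount of public randomness (not counted in the cost) but no prior entanglement. *)

(* Defs.v *)
From mathcomp Require Import all_boot all_order all_algebra.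
From mathcomp Require Import complex.
From mathcomp Require Import all_classical all_reals Rstruct Rstruct_topology exp.

Set Implicit Arguments.
Unset Strict Implicit.
Unset Printing Implicit Defensive.
Import GRing.Theory Num.Theory.
Local Open Scope ring_scope.

Definition Rr : realType := Rdefinitions.R.
Definition Rc := (Rr[i])%C.

(* Linear maps between finite-dimensional Hilbert spaces C^T, C^U     *)
(* (T, U finite index types).  [rop T U] = matrices mapping C^T to C^U *)
Definition rop (T U : finType) := U -> T -> Rc.
Definition op (T : finType) := rop T T.

Definition mulop (T U V : finType) (A : rop U V) (B : rop T U) : rop T V :=
  fun v t => \sum_(u : U) A v u * B u t.
Definition adjop (T U : finType) (A : rop T U) : rop U T :=
  fun t u => (A u t)^*.
Definition idop (T : finType) : op T := fun t t' => (t == t')%:R.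
Definition subop (T : finType) (A B : op T) : op T := fun t t' => A t t' - B t t'.
Definition trace (T : finType) (A : op T) : Rc := \sum_(t : T) A t t.
Definition kron (T U : finType) (A : op T) (B : op U) : op (T * U)%type :=
  fun p q => A p.1 q.1 * B p.2 q.2.

Definition psd (T : finType) (A : op T) : Prop :=
  forall v : T -> Rc, 0 <= \sum_(i : T) \sum_(j : T) (v i)^* * A i j * v j.

Definition density (T : finType) (rho : op T) : Prop := psd rho /\ trace rho = 1.
(* effect: the "accept" element of a two-outcome POVM, 0 <= E <= I *)
Definition effect (T : finType) (E : op T) : Prop := psd E /\ psd (subop (@idop T) E).

Definition kraus_tp (T U : finType) (ks : seq (rop T U)) : Prop :=
  forall t t' : T, \sum_(k <- ks) mulop (adjop k) k t t' = @idop T t t'.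

Definition apply_kraus (T : finType) (ks : seq (op T)) (rho : op T) : op T :=
  fun t t' => \sum_(k <- ks) mulop (mulop k rho) (adjop k) t t'.

Definition qreg (q : nat) : finType := 'I_(2 ^ q).
Definition qubit : finType := 'I_2.

Definition inp (n : nat) := n.-tuple bool.

(* Quantum SMP protocols (no shared randomness, no entanglement)       *)
(* Alice sends a state rho_x on a qubits, Bob sends sigma_y on b       *)
(* qubits; the referee applies a two-outcome POVM {M, I - M} on the    *)
(* joint a+b qubits and outputs 1 on outcome M.                        *)
Definition smp_ok (n : nat) (f : inp n -> inp n -> bool) (c : nat) : Prop :=
  exists (a b : nat) (rho : inp n -> op (qreg a)) (sigma : inp n -> op (qreg b))
         (M : op (qreg a * qreg b)%type),
    (a + b <= c)%N /\
    (forall x, density (rho x)) /\ (forall y, density (sigma y)) /\ effect M /\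
    forall x y,
      let p := trace (mulop M (kron (rho x) (sigma y))) in
      (f x y -> 2/3 <= p) /\ (~~ f x y -> p <= 1/3).

(* Interactive two-party quantum protocols without shared randomness  *)
(* and without prior entanglement.                                    *)
(* Alice's (resp. Bob's) workspace is C^(dA+1) (resp. C^(dB+1)),      *)
(* initialised to |0>.  The protocol has [qrounds] rounds; in round t *)
(* exactly one qubit is communicated: the sender (Alice iff            *)
(* [qsender t]) applies a channel (depending on her/his input) from    *)
(* the workspace to workspace (x) message-qubit, and the receiver      *)
(* applies a channel (depending on her/his input) from                 *)
(* workspace (x) message-qubit back to the workspace.  (Longer         *)
(* messages are sent as consecutive one-qubit rounds.)  At the end,    *)
(* the output party ([qoutA]: Alice, else Bob) measures a two-outcome  *)
(* POVM on his/her workspace (depending on the input).  Cost = number  *)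
(* of qubits communicated = [qrounds].                                 *)
Record qprot (n : nat) := QProt {
  qdA : nat;
  qdB : nat;
  qrounds : nat;
  qsender : nat -> bool;
  qAsend : nat -> inp n -> seq (rop 'I_qdA.+1 ('I_qdA.+1 * qubit)%type);
  qArecv : nat -> inp n -> seq (rop ('I_qdA.+1 * qubit)%type 'I_qdA.+1);
  qBsend : nat -> inp n -> seq (rop 'I_qdB.+1 ('I_qdB.+1 * qubit)%type);
  qBrecv : nat -> inp n -> seq (rop ('I_qdB.+1 * qubit)%type 'I_qdB.+1);
  qoutA : bool;
  qEA : inp n -> op 'I_qdA.+1;
  qEB : inp n -> op 'I_qdB.+1 }.

Arguments qdA {n} q.
Arguments qdB {n} q.
Arguments qrounds {n} q.
Arguments qsender {n} q _.
Arguments qAsend {n} q _ _.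
Arguments qArecv {n} q _ _.
Arguments qBsend {n} q _ _.
Arguments qBrecv {n} q _ _.
Arguments qoutA {n} q.
Arguments qEA {n} q _.
Arguments qEB {n} q _.

Section Protocol.
Variables (n : nat) (P : qprot n).
Local Notation A := ('I_(qdA P).+1).
Local Notation B := ('I_(qdB P).+1).
Local Notation AB := (A * B)%type.

Definition qvalid : Prop :=
  (forall t x, kraus_tp (qAsend P t x)) /\ (forall t x, kraus_tp (qArecv P t x)) /\
  (forall t y, kraus_tp (qBsend P t y)) /\ (forall t y, kraus_tp (qBrecv P t y)) /\
  (forall x, effect (qEA P x)) /\ (forall y, effect (qEB P y)).

(* Alice sends (Kraus K), Bob receives (Kraus L): joint Kraus operator on A*B *)
Definition joinA (K : rop A (A * qubit)%type) (L : rop (B * qubit)%type B) : op AB :=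
  fun p p' => \sum_(q : qubit) L p.2 (p'.2, q) * K (p.1, q) p'.1.
(* Bob sends (Kraus K), Alice receives (Kraus L) *)
Definition joinB (K : rop B (B * qubit)%type) (L : rop (A * qubit)%type A) : op AB :=
  fun p p' => \sum_(q : qubit) L p.1 (p'.1, q) * K (p.2, q) p'.2.

Definition round_kraus (x y : inp n) (t : nat) : seq (op AB) :=
  if qsender P t then [seq joinA K L | K <- qAsend P t x, L <- qBrecv P t y]
  else [seq joinB K L | K <- qBsend P t y, L <- qArecv P t x].

Definition init_state : op AB :=
  fun p p' => ((p == (ord0, ord0)) && (p' == (ord0, ord0)))%:R.

Fixpoint qstate (x y : inp n) (t : nat) : op AB :=
  match t with
  | 0 => init_state
  | t'.+1 => apply_kraus (round_kraus x y t') (qstate x y t')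
  end.

Definition qaccept (x y : inp n) : Rc :=
  let rho := qstate x y (qrounds P) in
  if qoutA P then trace (mulop (kron (qEA P x) (@idop B)) rho)
  else trace (mulop (kron (@idop A) (qEB P y)) rho).
End Protocol.

Definition pub_ok (n : nat) (f : inp n -> inp n -> bool) (c : nat) : Prop :=
  exists (m : nat) (p : 'I_m -> Rc) (P : 'I_m -> qprot n),
    (forall r, 0 <= p r) /\ \sum_(r < m) p r = 1 /\
    (forall r, qvalid (P r) /\ (qrounds (P r) <= c)%N) /\
    forall x y,
      let acc := \sum_(r < m) p r * qaccept (P r) x y in
      (f x y -> 2/3 <= acc) /\ (~~ f x y -> acc <= 1/3).

(* least natural number satisfying a predicate (0 if none) *)
Definition minnat (Q : nat -> Prop) : nat :=
  match pselect (exists k, Q k) with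
  | left h => ex_minn (P := fun k => `[< Q k >])
                (let: ex_intro k hk := h in ex_intro _ k (asboolT hk))
  | right _ => 0%N
  end.

Definition Qsmp (n : nat) (f : inp n -> inp n -> bool) : nat := minnat (smp_ok f).
Definition Qpub (n : nat) (f : inp n -> inp n -> bool) : nat := minnat (pub_ok f).

(* Main.v *)
Require Import Defs.
From mathcomp Require Import all_boot all_order all_algebra.
From mathcomp Require Import complex.
From mathcomp Require Import all_classical all_reals Rstruct Rstruct_topology sequences exp.
From mathcomp Require Import ring lra zify.
Import Order.TTheory GRing.Theory Num.Theory.
Set Implicit Arguments.
Unset Strict Implicit.
Unset Printing Implicit Defensive.
Local Open Scope ring_scope.

(* A c-qubit protocol has acceptance probability sum_{w,w'} G(w,w') H(w,w'),
   where w, w' range over 2^c message strings, G depends only on x and H only on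
   y, and both are Gram-like matrices whose entries have real and imaginary
   parts in [-1, 1].  So, for M = 2 * 4^c, the acceptance probability over M is
   the mean of products g_t(x) h_t(y) of numbers in [-1, 1], t ranging over
   public coins and real coordinates.  By a Chernoff and a union bound over all
   inputs, O(n M^2) sampled values of t suffice.  The sample turns x and y into
   unit vectors of dimension O(n M^2) with inner product (1 + z)/2, where z
   separates f = 1 from f = 0 by a gap of order 1/M.  These are sent as
   O(c + log n)-qubit fingerprints, and the referee thresholds the outcomes of
   O(M^2) = O(16^c) swap tests on independent copies. *)

(** * Chernoff bound for weighted samples *)

(** With [u = z - 2 z^2], [expR (- u) >= 1 - u] gives [expR u <= 1 / (1 - u)], and
    [(1 + z) (1 - u) = 1 + z^2 (1 + 2 z)] is at least 1. *)
Lemma one_plus_ge_expR (R : realType) (z : R) :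
  - (1 / 2) <= z -> expR (z - 2 * z ^+ 2) <= 1 + z.
Proof.
move=> hz.
have h1 : 0 < 1 - (z - 2 * z ^+ 2) by nra.
have h2 : expR (z - 2 * z ^+ 2) <= (1 - (z - 2 * z ^+ 2))^-1.
  rewrite -[leLHS]invrK -expRN lef_pV2 ?posrE ?expR_gt0 //.
  exact: expR_ge1Dx.
apply: le_trans h2 _; rewrite -[leRHS]divr1 -[leLHS]div1r.
rewrite ler_pdivrMr // divr1.
have -> : (1 + z) * (1 - (z - 2 * z ^+ 2)) = 1 + z ^+ 2 * (1 + 2 * z) by ring.
rewrite lerDl mulr_ge0 ?sqr_ge0 //; lra.
Qed.

(** Exponential-moment argument with the product of the [1 + l * Z (s i)] in place of an
    exponential. Its mean is at most [expR (- k l e)], while on the event it is at least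
    [expR (- 2 k l^2)]; Markov's inequality compares the two. *)
Lemma chernoff (R : realType) (T : finType) (k : nat) (w Z : T -> R) (e : R) :
  (forall t, 0 <= w t) -> \sum_t w t = 1 -> (forall t, `|Z t| <= 1) ->
  0 <= e -> \sum_t w t * Z t <= - e ->
  \sum_(s : {ffun 'I_k -> T} | 0 <= \sum_i Z (s i)) \prod_i w (s i)
    <= expR (- (k%:R * e ^+ 2 / 8)).
Proof.
move=> w0 w1 Z1 e0 he.
have e1 : e <= 1.
  suff : - 1 <= \sum_t w t * Z t by move=> h; have := le_trans h he; lra.
  rewrite -w1 -sumrN; apply: ler_sum => t _.
  have := Z1 t; rewrite ler_norml => /andP[h _].
  by rewrite -[leLHS]mulrN1 ler_wpM2l.
(* This value maximizes [l e - 2 l^2], whose maximum is [e^2 / 8]. *)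
pose l := e / 4.
have zb t : - (1/2) <= l * Z t.
  have := Z1 t; rewrite ler_norml => /andP[h1 h2]; rewrite /l; nra.
have fact_ge0 t : 0 <= 1 + l * Z t by have := zb t; lra.
have bound (s : {ffun 'I_k -> T}) : 0 <= \sum_i Z (s i) ->
   expR (- (k%:R * (2 * l ^+ 2))) <= \prod_i (1 + l * Z (s i)).
  move=> hs.
  apply: (@le_trans _ _ (\prod_(i < k) expR (l * Z (s i) - 2 * l ^+ 2))).
    rewrite -expR_sum ler_expR big_split /= sumrN sumr_const card_ord.
    rewrite -mulr_sumr -[X in _ - X]mulr_natl lerDr mulr_ge0 //.
    by rewrite /l divr_ge0.
  apply: ler_prod => i _; rewrite expR_ge0 /=.
  apply: le_trans (one_plus_ge_expR (zb (s i))).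
  rewrite ler_expR lerD2l lerN2 ler_wpM2l // exprMn.
  rewrite -[leRHS]mulr1 ler_wpM2l ?sqr_ge0 //.
  by rewrite -real_normK ?num_real // expr_le1.
have key : expR (- (k%:R * (2 * l ^+ 2))) *
   (\sum_(s : {ffun 'I_k -> T} | 0 <= \sum_i Z (s i)) \prod_i w (s i))
   <= expR (- (k%:R * (l * e))).
  apply: (@le_trans _ _ (\sum_(s : {ffun 'I_k -> T})
       \prod_(i < k) (w (s i) * (1 + l * Z (s i))))).
    rewrite mulr_sumr big_mkcond /=; apply: ler_sum => s _.
    rewrite big_split /=; case: ifP => hs; last first.
      by rewrite mulr_ge0 ?prodr_ge0.
    by rewrite mulrC ler_wpM2l ?prodr_ge0 // bound.
  rewrite -(bigA_distr_bigA (fun (i : 'I_k) t => w t * (1 + l * Z t))) /=.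
  rewrite prodr_const card_ord -mulrN expRM_natl.
  apply: lerXn2r; rewrite ?nnegrE ?expR_ge0 //.
    by apply: sumr_ge0 => t _; rewrite mulr_ge0.
  apply: le_trans (expR_ge1Dx _).
  under eq_bigr => t _ do rewrite mulrDr mulr1 mulrCA.
  rewrite big_split /= w1 -mulr_sumr lerD2l -mulrN.
  by rewrite ler_wpM2l // /l divr_ge0.
have := ler_wpM2l (expR_ge0 (k%:R * (2 * l ^+ 2))) key.
rewrite [leLHS]mulrA expRxMexpNx_1 mul1r => h; apply: le_trans h _.
by rewrite -expRD ler_expR /l; lra.
Qed.

(** * Gram matrices indexed by message strings *)

Section Gram.
Variables (W A : finType).
Implicit Types (E : op A) (V : seq (W -> A -> Rc)).

Definition gram E V (w w' : W) : Rc :=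
  \sum_(v <- V) \sum_a \sum_a' (v w' a)^* * E a a' * v w a'.

(** The normalization is for each [w] separately: the total over all [w] may reach [#|W|], as it
    does for a party that only receives. *)
Definition subunit V : Prop :=
  forall w, \sum_(v <- V) \sum_a v w a * (v w a)^* <= 1.

Lemma gram_diag_ge0 E V w : psd E -> 0 <= gram E V w w.
Proof. by move=> hE; apply: sumr_ge0 => v _; apply: hE. Qed.

Lemma gram_diag_le1 E V w : effect E -> subunit V -> gram E V w w <= 1.
Proof.
case=> _ hE hV; apply: le_trans (hV w); apply: ler_sum => v _.
rewrite -subr_ge0; have := hE (v w).
rewrite (_ : \sum_(i : A) _ = \sum_a v w a * (v w a)^* -
   \sum_a \sum_a' (v w a)^* * E a a' * v w a') // -sumrB.
apply: eq_bigr => a _; rewrite /subop /idop.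
under eq_bigr => b _ do rewrite mulrBr mulrBl.
rewrite sumrB; congr (_ - _).
rewrite (bigD1 a) //= eqxx mulr1 mulrC big1 ?addr0 // => b.
by rewrite eq_sym => /negPf->; rewrite mulr0 mul0r.
Qed.

(** The right-hand side is the quadratic form of [E] at [v w + c * v w'], summed over the family. *)
Lemma gram_polarization E V w w' (c : Rc) : psd E ->
  0 <= gram E V w w + c * c^* * gram E V w' w' +
       (c * gram E V w' w + c^* * gram E V w w').
Proof.
move=> hE.
have h : 0 <= \sum_(v <- V) \sum_a \sum_a'
    (v w a + c * v w' a)^* * E a a' * (v w a' + c * v w' a').
  by apply: sumr_ge0 => v _; apply: (hE (fun a => v w a + c * v w' a)).
apply: le_trans h _; rewrite /gram !mulr_sumr -!big_split /=.
rewrite le_eqVlt; apply/orP; left; apply/eqP; apply: eq_bigr => v _.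
rewrite !mulr_sumr -!big_split /=; apply: eq_bigr => a _.
rewrite !mulr_sumr -!big_split /=; apply: eq_bigr => b _.
rewrite rmorphD rmorphM /=; ring.
Qed.

Lemma ge0_complex (z : Rc) : 0 <= z -> (complex.Im z = 0) * (0 <= complex.Re z).
Proof. by rewrite lecE /= => /andP[/eqP-> ->]. Qed.

Lemma gram_bound E V w w' : effect E -> subunit V ->
  (`|complex.Re (gram E V w w')| <= 1) /\ (`|complex.Im (gram E V w w')| <= 1).
Proof.
move=> hE hV; case: (hE) => hE1 _.
have pol c := ge0_complex (gram_polarization V w w' c hE1).
have d0 u := ge0_complex (gram_diag_ge0 V u hE1).
have d1 u : complex.Re (gram E V u u) <= 1.
  by have := gram_diag_le1 u hE hV; rewrite lecE => /andP[_].
(* The vanishing imaginary parts give Hermitian symmetry. The real parts at [c = 1, -1] bound the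
   real part of the entry, those at [c = i, -i] its imaginary part, as the diagonal lies in
   [0, 1]. *)
move: (pol 1) (pol (-1)) (pol 'i%C) (pol (- 'i%C)) (d0 w) (d0 w') (d1 w) (d1 w').
case: (gram E V w w) => a a'; case: (gram E V w' w') => b b'.
case: (gram E V w' w) => c c'; case: (gram E V w w') => d d'.
rewrite !ler_norml /=.
move=> [h1 h1'] [h2 h2'] [h3 h3'] [h4 h4'] [h5 h5'] [h6 h6'] h7 h8.
by split; apply/andP; split; lra.
Qed.

End Gram.

(** * Factorization of the protocol state *)

(* Yao-Kremer decomposition: with w ranging over the qubits exchanged so far,
   rho is a mixture of the vectors sum_w v_w (x) u_w, where the family v depends
   only on Alice's Kraus operators and u only on Bob's. *)
Definition bipartite (W A B : finType) (v : W -> A -> Rc) (u : W -> B -> Rc)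
  (p : A * B) : Rc := \sum_w v w p.1 * u w p.2.

Definition decomposes (W A B : finType) (VA : seq (W -> A -> Rc))
    (VB : seq (W -> B -> Rc)) (rho : op (A * B)%type) : Prop :=
  forall p p', rho p p' =
    \sum_(v <- VA) \sum_(u <- VB) bipartite v u p * (bipartite v u p')^*.

Definition send_vec (W A : finType) (K : rop A (A * qubit)%type)
    (v : W -> A -> Rc) : W * qubit -> A -> Rc :=
  fun wq a => \sum_a1 K (a, wq.2) a1 * v wq.1 a1.

Definition recv_vec (W A : finType) (L : rop (A * qubit)%type A)
    (v : W -> A -> Rc) : W * qubit -> A -> Rc :=
  fun wq a => \sum_a1 L a (a1, wq.2) * v wq.1 a1.

Lemma big_pair (V : nmodType) (T U : finType) (F : T * U -> V) :
  \sum_p F p = \sum_t \sum_u F (t, u).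
Proof. by rewrite pair_bigA; apply: eq_bigr => -[]. Qed.

(** The left side is the quadratic form of the sum of the [k^* k] at [x], and that sum is the
    identity. *)
Lemma kraus_norm (T U : finType) (ks : seq (rop T U)) (x : T -> Rc) :
  kraus_tp ks ->
  \sum_(k <- ks) \sum_u (\sum_t k u t * x t) * (\sum_t k u t * x t)^* =
  \sum_t x t * (x t)^*.
Proof.
move=> tp.
transitivity (\sum_t \sum_t' x t * (x t')^* *
    \sum_(k <- ks) mulop (adjop k) k t' t).
  under [RHS]eq_bigr => t _ do (under eq_bigr => t' _ do rewrite mulr_sumr).
  under [RHS]eq_bigr => t _ do rewrite exchange_big /=.
  rewrite [RHS]exchange_big /=; apply: eq_bigr => k _.
  under [RHS]eq_bigr => t _ do (under eq_bigr => t' _ do rewrite mulr_sumr).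
  under [RHS]eq_bigr => t _ do rewrite exchange_big /=.
  rewrite [RHS]exchange_big /=; apply: eq_bigr => u _.
  rewrite mulr_suml; apply: eq_bigr => t _.
  rewrite rmorph_sum mulr_sumr; apply: eq_bigr => t' _.
  rewrite rmorphM /adjop /=; ring.
apply: eq_bigr => t _; under eq_bigr => t' _ do rewrite tp /idop.
rewrite (bigD1 t) //= eqxx mulr1 big1 ?addr0 // => t' /negPf ->.
by rewrite mulr0.
Qed.

(** Fixing the value [q] of the sent qubit keeps only part of a squared norm that the channel
    preserves. *)
Lemma subunit_send (W A : finType) (Ks : seq (rop A (A * qubit)%type))
    (V : seq (W -> A -> Rc)) :
  kraus_tp Ks -> subunit V -> subunit [seq send_vec K v | K <- Ks, v <- V].
Proof.
move=> tp hV [w q]; rewrite big_allpairs_dep exchange_big /=.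
apply: le_trans (hV w); apply: ler_sum => v _.
rewrite -(kraus_norm (v w) tp); apply: ler_sum => K _.
rewrite [leRHS]big_pair.
apply: ler_sum => a _; rewrite (bigD1 q) //= lerDl.
by apply: sumr_ge0 => q' _; apply: mul_conjC_ge0.
Qed.

(** The receiver applies a channel to [v w] tensored with the basis state [q], a vector of the same
    norm as [v w]. *)
Lemma subunit_recv (W A : finType) (Ls : seq (rop (A * qubit)%type A))
    (V : seq (W -> A -> Rc)) :
  kraus_tp Ls -> subunit V -> subunit [seq recv_vec L v | L <- Ls, v <- V].
Proof.
move=> tp hV [w q]; rewrite big_allpairs_dep exchange_big /=.
apply: le_trans (hV w); apply: ler_sum => v _.
pose x (t : A * qubit) : Rc := if t.2 == q then v w t.1 else 0.
have xE (F : A * qubit -> Rc -> Rc) : (forall t, F t 0 = 0) ->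
    \sum_t F t (x t) = \sum_a F (a, q) (v w a).
  move=> F0; rewrite big_pair.
  apply: eq_bigr => a _; rewrite (bigD1 q) //= /x eqxx big1 ?addr0 // => q'.
  by move=> /negPf /= ->.
have := kraus_norm x tp; rewrite (xE (fun _ z => z * z^*)); last first.
  by move=> t; rewrite mul0r.
move=> <-; rewrite le_eqVlt; apply/orP; left; apply/eqP.
apply: eq_bigr => L _; apply: eq_bigr => b _.
by rewrite (xE (fun t z => L b t * z)) // => t; rewrite mulr0.
Qed.

Lemma apply_kraus_decomposes (T : finType) (I J : Type) (r : seq I) (s : seq J)
    (psi : I -> J -> T -> Rc) (ks : seq (op T)) (rho : op T) :
  (forall p p', rho p p' = \sum_(i <- r) \sum_(j <- s) psi i j p * (psi i j p')^*) ->
  forall p p', apply_kraus ks rho p p' =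
   \sum_(k <- ks) \sum_(i <- r) \sum_(j <- s)
     (\sum_q k p q * psi i j q) * (\sum_q k p' q * psi i j q)^*.
Proof.
move=> h p p'; apply: eq_bigr => k _; rewrite /mulop /adjop.
under eq_bigr => q _ do rewrite mulr_suml.
transitivity (\sum_q \sum_q' \sum_(i <- r) \sum_(j <- s)
   (k p q' * psi i j q') * (k p' q * psi i j q)^*).
  apply: eq_bigr => q _; apply: eq_bigr => q' _.
  rewrite h mulr_sumr mulr_suml; apply: eq_bigr => i _.
  rewrite mulr_sumr mulr_suml; apply: eq_bigr => j _.
  rewrite rmorphM /=; ring.
under eq_bigr => q _ do rewrite exchange_big /=.
rewrite exchange_big /=; apply: eq_bigr => i _.
under eq_bigr => q _ do rewrite exchange_big /=.
rewrite exchange_big /=; apply: eq_bigr => j _.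
rewrite exchange_big /= mulr_suml; apply: eq_bigr => q _.
by rewrite rmorph_sum mulr_sumr.
Qed.

(** The sum over the message qubit inside a joint Kraus operator becomes a sum over the last
    component of the longer string, so a round preserves the bipartite form. *)
Lemma bipartite_round (W A B : finType) (K : rop A (A * qubit)%type)
    (L : rop (B * qubit)%type B) (v : W -> A -> Rc) (u : W -> B -> Rc) p :
  bipartite (send_vec K v) (recv_vec L u) p =
  \sum_q (\sum_(b : qubit) L p.2 (q.2, b) * K (p.1, b) q.1) * bipartite v u q.
Proof.
rewrite /bipartite big_pair exchange_big /=.
transitivity (\sum_(b : qubit) \sum_w \sum_q
   L p.2 (q.2, b) * K (p.1, b) q.1 * (v w q.1 * u w q.2)).
  apply: eq_bigr => b _; apply: eq_bigr => w _; rewrite /send_vec /recv_vec /=.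
  rewrite mulr_suml big_pair.
  apply: eq_bigr => a _; rewrite mulr_sumr; apply: eq_bigr => b1 _; ring.
under [LHS]eq_bigr => b _ do rewrite exchange_big /=.
rewrite [LHS]exchange_big /=; apply: eq_bigr => q _.
rewrite mulr_suml; apply: eq_bigr => b _.
by rewrite mulr_sumr.
Qed.

Lemma bipartiteC (W A B : finType) (v : W -> A -> Rc) (u : W -> B -> Rc) p :
  bipartite v u p = bipartite u v (p.2, p.1).
Proof. by apply: eq_bigr => w _; rewrite mulrC. Qed.

(** Expanding both copies of each bipartite vector produces a pair [w, w']; for a fixed pair, the
    sums over Alice's and Bob's spaces separate. *)
Lemma trace_kron_gram (W A B : finType) VA VB (EA : op A) (EB : op B)
    (rho : op (A * B)%type) : @decomposes W A B VA VB rho ->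
  trace (mulop (kron EA EB) rho) =
  \sum_w \sum_w' gram EA VA w w' * gram EB VB w w'.
Proof.
move=> dec; rewrite /trace /mulop.
transitivity (\sum_(v <- VA) \sum_(u <- VB) \sum_w \sum_w'
  (\sum_a \sum_a' (v w' a)^* * EA a a' * v w a') *
  (\sum_b \sum_b' (u w' b)^* * EB b b' * u w b')).
  transitivity (\sum_p \sum_p' \sum_(v <- VA) \sum_(u <- VB)
    kron EA EB p p' * (bipartite v u p' * (bipartite v u p)^*)).
    apply: eq_bigr => p _; apply: eq_bigr => p' _; rewrite dec mulr_sumr.
    by apply: eq_bigr => v _; rewrite mulr_sumr.
  under [LHS]eq_bigr => p _ do rewrite exchange_big /=.
  rewrite [LHS]exchange_big /=; apply: eq_bigr => v _.
  under [LHS]eq_bigr => p _ do rewrite exchange_big /=.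
  rewrite [LHS]exchange_big /=; apply: eq_bigr => u _.
  transitivity (\sum_p \sum_p' \sum_w \sum_w'
     ((v w' p.1)^* * EA p.1 p'.1 * v w p'.1) *
     ((u w' p.2)^* * EB p.2 p'.2 * u w p'.2)).
    apply: eq_bigr => p _; apply: eq_bigr => p' _.
    rewrite /bipartite rmorph_sum mulr_suml mulr_sumr; apply: eq_bigr => w _.
    rewrite mulr_sumr mulr_sumr; apply: eq_bigr => w' _.
    rewrite rmorphM /kron /=; ring.
  under [LHS]eq_bigr => p _ do rewrite exchange_big /=.
  rewrite [LHS]exchange_big /=; apply: eq_bigr => w _.
  under [LHS]eq_bigr => p _ do rewrite exchange_big /=.
  rewrite [LHS]exchange_big /=; apply: eq_bigr => w' _.
  rewrite big_pair.
  rewrite mulr_suml; apply: eq_bigr => a _.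
  rewrite mulr_sumr; apply: eq_bigr => b _.
  rewrite big_pair.
  rewrite mulr_suml; apply: eq_bigr => a' _.
  by rewrite mulr_sumr.
under [LHS]eq_bigr => v _ do rewrite exchange_big /=.
rewrite [LHS]exchange_big /=; apply: eq_bigr => w _.
under [LHS]eq_bigr => v _ do rewrite exchange_big /=.
rewrite [LHS]exchange_big /=; apply: eq_bigr => w' _.
rewrite mulr_suml; apply: eq_bigr => v _.
by rewrite mulr_sumr.
Qed.

Section Protocol.
Variables (n : nat) (P : qprot n).
Hypothesis valP : qvalid P.
Local Notation A := 'I_(qdA P).+1.
Local Notation B := 'I_(qdB P).+1.

Lemma qstate_decomposes t :
  exists (W : finType) (VA : inp n -> seq (W -> A -> Rc))
         (VB : inp n -> seq (W -> B -> Rc)),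
    #|W| = (2 ^ t)%N /\ (forall x, subunit (VA x)) /\ (forall y, subunit (VB y)) /\
    forall x y, decomposes (VA x) (VB y) (@qstate n P x y t).
Proof.
case: valP => [tpAs [tpAr [tpBs [tpBr _]]]].
elim: t => [|t [W [VA [VB [cW [sA [sB dec]]]]]]].
  exists unit, (fun _ => [:: fun _ a => (a == ord0)%:R]),
    (fun _ => [:: fun _ b => (b == ord0)%:R]).
  have sub1 k : subunit [:: fun (_ : unit) (a : 'I_k.+1) => (a == ord0)%:R : Rc].
    move=> w; rewrite big_seq1 (bigD1 ord0) //= ?eqxx mul1r rmorph1 big1 ?addr0 //.
    by move=> i /negPf->; rewrite mul0r.
  split; first by rewrite card_unit.
  split; first by move=> _; apply: sub1.
  split; first by move=> _; apply: sub1.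
  move=> x y [a b] [a' b']; rewrite !big_seq1 /bipartite /=.
  rewrite !big_const !card_unit /= !addr0 /init_state.
  by rewrite -!natrM !mulnb conjC_nat -natrM mulnb.
exists (W * qubit)%type.
case: (boolP (qsender P t)) => snd.
- exists (fun x => [seq send_vec K v | K <- qAsend P t x, v <- VA x]),
         (fun y => [seq recv_vec L u | L <- qBrecv P t y, u <- VB y]).
  split; first by rewrite card_prod cW card_ord expnSr.
  split; first by move=> x; apply: subunit_send.
  split; first by move=> y; apply: subunit_recv.
  move=> x y p p' /=.
  rewrite (apply_kraus_decomposes _ (dec x y)) /round_kraus snd.
  rewrite !big_allpairs_dep /=; apply: eq_bigr => K _.
  rewrite exchange_big /=; apply: eq_bigr => v _.
  rewrite big_allpairs_dep /=; apply: eq_bigr => L _; apply: eq_bigr => u _.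
  by rewrite !bipartite_round.
- exists (fun x => [seq recv_vec L v | L <- qArecv P t x, v <- VA x]),
         (fun y => [seq send_vec K u | K <- qBsend P t y, u <- VB y]).
  split; first by rewrite card_prod cW card_ord expnSr.
  split; first by move=> x; apply: subunit_recv.
  split; first by move=> y; apply: subunit_send.
  move=> x y p p' /=.
  rewrite (apply_kraus_decomposes _ (dec x y)) /round_kraus (negPf snd).
  rewrite !big_allpairs_dep exchange_big /=; apply: eq_bigr => L _.
  rewrite exchange_big /=; apply: eq_bigr => v _.
  rewrite big_allpairs_dep /=; apply: eq_bigr => K _; apply: eq_bigr => u _.
  (* When Bob sends, the round identity is applied with the parties exchanged. *)
  have E r : bipartite (recv_vec L v) (send_vec K u) r =
      \sum_q joinB K L r q * bipartite v u q.
    rewrite bipartiteC bipartite_round /=.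
    rewrite big_pair exchange_big big_pair /=.
    apply: eq_bigr => a _; apply: eq_bigr => b _.
    by rewrite [in RHS]bipartiteC.
  by rewrite !E.
Qed.

End Protocol.

(** * Acceptance probabilities as bounded real inner products *)

(** Values along the enumeration of [D], then zeros: protocols with different numbers of rounds thus
    share one index set, and inner products do not change. *)
Definition pad (R : nzRingType) (D : finType) (M : nat) (g : D -> R) (i : 'I_M) : R :=
  nth 0 [seq g d | d <- enum D] i.

Lemma pad_dot (R : nzRingType) (D : finType) (M : nat) (g h : D -> R) :
  (#|D| <= M)%N -> \sum_(i < M) pad g i * pad h i = \sum_d g d * h d.
Proof.
move=> hM; rewrite -[RHS]big_enum /= -[RHS](big_map (fun d => g d * h d) predT id).
rewrite (big_nth 0) size_map -cardE /=.
rewrite big_mkord /= (big_ord_widen _ (fun i => nth 0 [seq g d * h d | d <- enum D] i) hM).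
rewrite [RHS]big_mkcond /=; apply: eq_bigr => i _; rewrite /pad.
case: ifP => [hi|/negbT]; last first.
  rewrite -leqNgt => hi; rewrite [X in X * _]nth_default ?mul0r //.
  by rewrite size_map -cardE.
have [x0] : exists x0 : D, True.
  by case/card_gt0P: (leq_ltn_trans (leq0n i) hi) => x _; exists x.
by move=> _; rewrite !(nth_map x0) -?enumT -?cardE.
Qed.

Lemma pad_le1 (R : numDomainType) (D : finType) (M : nat) (g : D -> R) (i : 'I_M) :
  (forall d, `|g d| <= 1) -> `|pad g i| <= 1.
Proof.
move=> hg; rewrite /pad; case: (ltnP i (size [seq g d | d <- enum D])) => hi.
  by have /mapP[d _ ->] := mem_nth 0 hi.
by rewrite nth_default ?normr0.
Qed.

Lemma effect_id (T : finType) : effect (@idop T).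
Proof.
split=> v; last first.
  by apply: sumr_ge0 => i _; apply: sumr_ge0 => j _; rewrite /subop subrr mulr0 mul0r.
apply: sumr_ge0 => i _; rewrite (bigD1 i) //= big1 ?addr0.
  by rewrite /idop eqxx mulr1 mulrC mul_conjC_ge0.
by move=> j; rewrite eq_sym /idop => /negPf->; rewrite mulr0 mul0r.
Qed.

Lemma Re_mulE (a b : Rc) : complex.Re (a * b) =
  complex.Re a * complex.Re b - complex.Im a * complex.Im b.
Proof. by case: a b => [a a'] [b b']. Qed.

Lemma Re_sum (I : Type) (r : seq I) (P : pred I) (F : I -> Rc) :
  complex.Re (\sum_(i <- r | P i) F i) = \sum_(i <- r | P i) complex.Re (F i).
Proof. exact: (raddf_sum (@complex.Re Rr)). Qed.

Lemma gram_pair_factor n (W A B : finType) (EA : inp n -> op A) (EB : inp n -> op B)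
    (VA : inp n -> seq (W -> A -> Rc)) (VB : inp n -> seq (W -> B -> Rc)) M :
  (forall x, effect (EA x)) -> (forall y, effect (EB y)) ->
  (forall x, subunit (VA x)) -> (forall y, subunit (VB y)) ->
  (2 * #|W| ^ 2 <= M)%N ->
  exists (g h : inp n -> 'I_M -> Rr),
    (forall x i, `|g x i| <= 1) /\ (forall y i, `|h y i| <= 1) /\
    forall x y, complex.Re
      (\sum_w \sum_w' gram (EA x) (VA x) w w' * gram (EB y) (VB y) w w') =
      \sum_i g x i * h y i.
Proof.
move=> eA eB sA sB hM.
(* The boolean selects real or imaginary part. The sign in [h] accounts for the minus in the real
   part of a complex product. *)
pose g x (d : (W * W) * bool) := let z := gram (EA x) (VA x) d.1.1 d.1.2 in
   if d.2 then complex.Re z else complex.Im z.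
pose h y (d : (W * W) * bool) := let z := gram (EB y) (VB y) d.1.1 d.1.2 in
   if d.2 then complex.Re z else - complex.Im z.
exists (fun x => pad (g x)), (fun y => pad (h y)); split.
  by move=> x i; apply: pad_le1 => -[[w w'] []];
    case: (gram_bound w w' (eA x) (sA x)).
split.
  move=> y i; apply: pad_le1 => -[[w w'] []] /=; rewrite /h /= ?normrN;
    by case: (gram_bound w w' (eB y) (sB y)).
move=> x y; rewrite pad_dot; last first.
  by rewrite !card_prod card_bool -mulnn mulnC in hM *.
rewrite !big_pair Re_sum; apply: eq_bigr => w _.
rewrite Re_sum; apply: eq_bigr => w' _.
by rewrite big_bool /g /h /= Re_mulE mulrN.
Qed.

Lemma qaccept_factor n (P : qprot n) c : qvalid P -> (qrounds P <= c)%N ->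
  exists (g h : inp n -> 'I_(2 * 4 ^ c) -> Rr),
    (forall x i, `|g x i| <= 1) /\ (forall y i, `|h y i| <= 1) /\
    forall x y, complex.Re (qaccept P x y) = \sum_i g x i * h y i.
Proof.
move=> valP hc; case: (valP) => _ [_ [_ [_ [eA eB]]]].
have [W [VA [VB [cW [sA [sB dec]]]]]] := qstate_decomposes valP (qrounds P).
have hM : (2 * #|W| ^ 2 <= 2 * 4 ^ c)%N.
  by rewrite cW leq_mul2l /= -expnM mulnC expnM leq_exp2l.
have id1 k (x : inp n) := @effect_id 'I_k.+1.
rewrite /qaccept; case: (qoutA P).
  have [g [h [bg [bh E]]]] := gram_pair_factor eA (id1 _) sA sB hM.
  exists g, h; do 2!split => //; move=> x y.
  by rewrite -E (trace_kron_gram _ _ (dec x y)).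
have [g [h [bg [bh E]]]] := gram_pair_factor (id1 _) eB sA sB hM.
exists g, h; do 2!split => //; move=> x y.
by rewrite -E (trace_kron_gram _ _ (dec x y)).
Qed.

(** * Derandomization by sampling *)

(** If every sample failed at some [x], the failure events would cover total weight 1, yet their
    Chernoff bounds add up to less than 1. *)
Lemma union_bound_sample (R : realType) (T X : finType) (k : nat) (w : T -> R)
    (Z : X -> T -> R) (e : R) :
  (forall t, 0 <= w t) -> \sum_t w t = 1 -> (forall x t, `|Z x t| <= 1) ->
  0 <= e -> (forall x, \sum_t w t * Z x t <= - e) ->
  #|X|%:R * expR (- (k%:R * e ^+ 2 / 8)) < 1 ->
  exists s : {ffun 'I_k -> T}, forall x, \sum_i Z x (s i) < 0.
Proof.
move=> w0 w1 Z1 e0 he hX; apply: contrapT => no.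
move: hX; rewrite ltNge => /negP; apply.
have W1 : \sum_(s : {ffun 'I_k -> T}) \prod_i w (s i) = 1.
  by rewrite -(bigA_distr_bigA (fun (i : 'I_k) t => w t)) /= w1 prodr_const expr1n.
apply: (@le_trans _ _ (\sum_x \sum_(s : {ffun 'I_k -> T} | 0 <= \sum_i Z x (s i))
    \prod_i w (s i))); last first.
  rewrite mulr_natl -[X in _ <= X]sumr_const; apply: ler_sum => x _.
  exact: chernoff.
rewrite (exchange_big_dep predT) //= -[leLHS]W1; apply: ler_sum => s _.
have [x hx] : exists x, 0 <= \sum_i Z x (s i).
  apply: contrapT => hs; apply: no; exists s => x.
  by rewrite ltNge; apply/negP => h; apply: hs; exists x.
by rewrite (bigD1 x) //= lerDl sumr_ge0 // => *; rewrite prodr_ge0.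
Qed.

(** This closes the union bound over the [4 ^ n] input pairs; it holds because [expR 1 > 2]. *)
Lemma pow4_expR_lt1 (R : realType) n : (0 < n)%N ->
  (4 ^ n)%:R * expR (- (n%:R * 2)) < 1 :> R.
Proof.
move=> n0; rewrite -mulrN expRM_natl natrX -exprMn.
have h1 : 0 <= 4 * expR (- 2) :> R by rewrite mulr_ge0 ?expR_ge0.
suff h2 : 4 * expR (- 2) < 1 :> R by rewrite exprn_ilt1 // -lt0n.
rewrite expRN ltr_pdivrMr ?expR_gt0 // mul1r.
have h : 2 < expR 1 :> R by apply: le_lt_trans (expR_gt1Dx _); [lra|rewrite oner_eq0].
have -> : expR 2 = expR 1 ^+ 2 :> R by rewrite -expRM_natl mulr1.
nra.
Qed.

Lemma real_complex_frac (a b : nat) : (a%:R / b%:R : Rc) = (a%:R / b%:R : Rr)%:C%C.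
Proof. by rewrite rmorphM fmorphV !rmorph_nat. Qed.

Lemma le_real_complex (a b : Rr) : (a%:C%C <= b%:C%C :> Rc) = (a <= b).
Proof. by rewrite lecE /= eqxx. Qed.

Lemma frac_le_complex (a b : nat) (z : Rc) : a%:R / b%:R <= z ->
  a%:R / b%:R <= complex.Re z.
Proof. by rewrite real_complex_frac lecE /= => /andP[]. Qed.

Lemma complex_le_frac (a b : nat) (z : Rc) : z <= a%:R / b%:R ->
  complex.Re z <= a%:R / b%:R.
Proof. by rewrite real_complex_frac lecE /= => /andP[]. Qed.

(** The coordinate is drawn uniformly together with the public coin, which divides both probability
    thresholds by [2 * 4 ^ c]. *)
Lemma pub_ok_factor n (f : inp n -> inp n -> bool) c : pub_ok f c ->
  exists (m : nat) (w : 'I_m * 'I_(2 * 4 ^ c) -> Rr)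
    (g h : inp n -> 'I_m * 'I_(2 * 4 ^ c) -> Rr),
    (forall t, 0 <= w t) /\ \sum_t w t = 1 /\
    (forall x t, `|g x t| <= 1) /\ (forall y t, `|h y t| <= 1) /\
    forall x y, let mu := \sum_t w t * (g x t * h y t) in
      (f x y -> 2 / 3 / (2 * 4 ^ c)%:R <= mu) /\
      (~~ f x y -> mu <= 1 / 3 / (2 * 4 ^ c)%:R).
Proof.
case=> m [p [P [p0 [p1 [valP acc]]]]].
have /choice[g /choice[h gh]] : forall r, exists g,
  exists h : inp n -> 'I_(2 * 4 ^ c) -> Rr,
    (forall x i, `|g x i| <= 1) /\ (forall y i, `|h y i| <= 1) /\
    forall x y, complex.Re (qaccept (P r) x y) = \sum_i g x i * h y i.
  by move=> r; case: (valP r) => v hr; apply: qaccept_factor.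
have M0 : (0 : Rr) < (2 * 4 ^ c)%:R by rewrite ltr0n muln_gt0 expn_gt0.
have Rp0 r := ge0_complex (p0 r).
exists m, (fun t => complex.Re (p t.1) / (2 * 4 ^ c)%:R),
  (fun x t => g t.1 x t.2), (fun y t => h t.1 y t.2).
split; first by move=> t; rewrite divr_ge0 ?Rp0 // ltW.
split.
  have E r : \sum_(i < 2 * 4 ^ c) complex.Re (p r) / (2 * 4 ^ c)%:R = complex.Re (p r).
    by rewrite sumr_const card_ord -[LHS]mulr_natr divfK // gt_eqF.
  by rewrite big_pair /= (eq_bigr _ (fun r _ => E r)) -Re_sum p1.
split; first by move=> x t; case: (gh t.1).
split; first by move=> y t; case: (gh t.1) => _ [].
move=> x y mu.
have -> : mu = complex.Re (\sum_(r < m) p r * qaccept (P r) x y) / (2 * 4 ^ c)%:R.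
  rewrite /mu big_pair Re_sum mulr_suml; apply: eq_bigr => r _ /=.
  rewrite Re_mulE Rp0 mul0r subr0; case: (gh r) => _ [_ ->].
  by rewrite mulrAC mulr_sumr.
case: (acc x y) => h1 h0; split => hf; rewrite ler_pM2r ?invr_gt0 //.
  exact: (frac_le_complex (h1 hf)).
exact: (@complex_le_frac 1 3 _ (h0 hf)).
Qed.

Lemma pub_ok_sample n (f : inp n -> inp n -> bool) c (M := (2 * 4 ^ c)%N)
    (N := ((96 * M) ^ 2 * n)%N) : (0 < n)%N -> pub_ok f c ->
  exists (g h : inp n -> 'I_N -> Rr),
    (forall x i, `|g x i| <= 1) /\ (forall y i, `|h y i| <= 1) /\
    forall x y, let z := (\sum_i g x i * h y i) / N%:R in
      (f x y -> 7 / 12 / M%:R <= z) /\ (~~ f x y -> z <= 5 / 12 / M%:R).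
Proof.
move=> n0 /pub_ok_factor[m [w [g [h [w0 [w1 [bg [bh mean]]]]]]]].
rewrite -/M in w g h w0 w1 bg bh mean *.
have M0 : (0 : Rr) < M%:R by rewrite ltr0n muln_gt0 expn_gt0.
have M1 : (2 : Rr) <= M%:R by rewrite (ler_nat _ 2) leq_pmulr // expn_gt0.
have N0 : (0 : Rr) < N%:R. by rewrite ltr0n muln_gt0 expn_gt0 n0 muln_gt0 /M muln_gt0 expn_gt0.
have iM0 : (0 : Rr) < M%:R^-1 by rewrite invr_gt0.
have iM2 : M%:R^-1 <= (2^-1 : Rr) by rewrite lef_pV2 // posrE.
(* A negative sum means that the sample is correct at [q]. The cutoffs 7/12 and 5/12 lie 1/12 inside
   2/3 and 1/3; halving keeps [Z] in [-1, 1] and leaves a margin of 1/24, over [M]. *)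
pose Z (q : inp n * inp n) t := let v := g q.1 t * h q.2 t in
  if f q.1 q.2 then (7 / 12 / M%:R - v) / 2 else (v - 5 / 12 / M%:R) / 2.
have bv x y t : `|g x t * h y t| <= 1 by rewrite normrM mulr_ile1.
have Z1 q t : `|Z q t| <= 1.
  have := bv q.1 q.2 t; rewrite /Z !ler_norml => /andP[h1 h2].
  by case: ifP => _; apply/andP; split; lra.
have mZ q : \sum_t w t * Z q t <= - (1 / 24 / M%:R).
  have [] := mean q.1 q.2; rewrite /Z; case: (f q.1 q.2) => [/(_ isT) h1 _|_ /(_ isT) h1].
    rewrite (_ : \sum_t _ = (7 / 12 / M%:R - \sum_t w t * (g q.1 t * h q.2 t)) / 2); first lra.
    rewrite -{2}[7 / 12 / M%:R]mul1r -w1 mulr_suml -sumrB mulr_suml.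
    by apply: eq_bigr => t _; ring.
  rewrite (_ : \sum_t _ = (\sum_t w t * (g q.1 t * h q.2 t) - 5 / 12 / M%:R) / 2); first lra.
  rewrite -{2}[5 / 12 / M%:R]mul1r -w1 mulr_suml -sumrB mulr_suml.
  by apply: eq_bigr => t _; ring.
have e0 : 0 <= 1 / 24 / M%:R :> Rr by lra.
have small : #|{: inp n * inp n}|%:R * expR (- (N%:R * (1 / 24 / M%:R) ^+ 2 / 8)) < 1 :> Rr.
  rewrite card_prod card_tuple card_bool -expnMn.
  (* The factor [96 ^ 2] in [N] makes the exponent exactly [2 n]. *)
  rewrite (_ : N%:R * _ / 8 = n%:R * 2); first exact: pow4_expR_lt1.
  rewrite /N natrM natrX natrM; field; exact: lt0r_neq0.
have [s hs] := union_bound_sample w0 w1 Z1 e0 mZ small.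
exists (fun x i => g x (s i)), (fun y i => h y (s i)).
split=> //; split=> // x y z; have := hs (x, y); rewrite /Z /=.
have cN (a : Rr) : \sum_(i < N) a = N%:R * a by rewrite sumr_const card_ord mulr_natl.
case: (f x y); rewrite -mulr_suml pmulr_llt0 ?invr_gt0 // sumrB cN subr_lt0 => hz.
  by split => // _; rewrite /z ler_pdivlMr // mulrC ltW.
by split => // _; rewrite /z ler_pdivrMr // mulrC ltW.
Qed.

(** * Swap tests on independent copies *)

Lemma big_pair_cond (V : nmodType) (T U : finType) (Q : pred T) (F : T * U -> V) :
  \sum_(p | Q p.1) F p = \sum_(t | Q t) \sum_u F (t, u).
Proof.
rewrite big_mkcond big_pair [RHS]big_mkcond; apply: eq_bigr => t _ /=.
by case: ifP => // _; rewrite big1.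
Qed.

(** The quadratic form at [v] is a sum of squared moduli, one for each [j]. *)
Lemma psd_real_gram (T J : finType) (Q : pred J) (B : J -> T -> Rr) (M : op T) :
  (forall p p', M p p' = (\sum_(j | Q j) B j p * B j p')%:C%C) -> psd M.
Proof.
move=> hM v.
rewrite (_ : \sum_i _ = \sum_(j | Q j) (\sum_p (B j p)%:C%C * v p)^* *
                      (\sum_p (B j p)%:C%C * v p)); last first.
  transitivity (\sum_i \sum_i' \sum_(j | Q j)
     ((B j i)%:C%C * v i)^* * ((B j i')%:C%C * v i')).
    apply: eq_bigr => i _; apply: eq_bigr => i' _.
    rewrite hM rmorph_sum mulr_sumr mulr_suml; apply: eq_bigr => j _.
    have rc (b : Rr) : (b%:C%C : Rc)^* = b%:C%C by apply/eqP; rewrite eq_complex /= oppr0 !eqxx.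
    rewrite rmorphM [X in _ = X * _]rmorphM /= rc; ring.
  under [LHS]eq_bigr => i _ do rewrite exchange_big /=.
  rewrite [LHS]exchange_big /=; apply: eq_bigr => j _.
  rewrite rmorph_sum mulr_suml; apply: eq_bigr => i _.
  by rewrite mulr_sumr.
by apply: sumr_ge0 => j _; rewrite mulrC mul_conjC_ge0.
Qed.

Section SwapTest.
Variable D : finType.
Local Notation R := Rr.

Definition swap (q : D * D) : D * D := (q.2, q.1).

(* [true]: projection onto the symmetric subspace; [false]: antisymmetric. *)
Definition swap_proj (b : bool) (q q' : D * D) : R :=
  ((q == q')%:R + (-1) ^+ (~~ b) * (swap q == q')%:R) / 2.

Lemma swapK : involutive swap. Proof. by case. Qed.

Lemma sum_delta (T : finType) (r : T) (F : T -> R) :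
  \sum_q (r == q)%:R * F q = F r.
Proof.
rewrite (bigD1 r) //= eqxx mul1r big1 ?addr0 // => q.
by rewrite eq_sym => /negPf->; rewrite mul0r.
Qed.

Lemma swap_proj_apply b q (F : D * D -> R) :
  \sum_q' swap_proj b q q' * F q' = (F q + (-1) ^+ (~~ b) * F (swap q)) / 2.
Proof.
transitivity (((\sum_q' (q == q')%:R * F q') +
   (-1) ^+ (~~ b) * \sum_q' (swap q == q')%:R * F q') / 2).
  rewrite mulr_sumr -big_split mulr_suml; apply: eq_bigr => q' _.
  by rewrite /swap_proj /=; ring.
by rewrite !sum_delta.
Qed.

Lemma swap_projC b q q' : swap_proj b q q' = swap_proj b q' q.
Proof.
rewrite /swap_proj eq_sym; congr ((_ + _ * _%:R) / 2).
by rewrite -(inj_eq (inv_inj swapK)) swapK eq_sym.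
Qed.

(** Idempotence, written with the first factor transposed so that the projector appears as a Gram
    matrix, as [psd_real_gram] expects. *)
Lemma swap_proj_idem b q q' :
  \sum_r swap_proj b r q * swap_proj b r q' = swap_proj b q q'.
Proof.
under eq_bigr => r _ do rewrite swap_projC.
rewrite swap_proj_apply /swap_proj swapK.
by case: b; rewrite ?expr0 ?expr1; field.
Qed.

Lemma swap_proj_sum q q' : \sum_b swap_proj b q q' = (q == q')%:R.
Proof. by rewrite big_bool /swap_proj /= expr0 expr1; field. Qed.

Definition swap_prob (b : bool) (ip : R) : R := (1 + (-1) ^+ (~~ b) * ip ^+ 2) / 2.

(** The identity part contributes the product of the squared norms, the swap part the squared inner
    product. *)
Lemma swap_proj_prob b (v u : D -> R) :
  \sum_i v i * v i = 1 -> \sum_i u i * u i = 1 ->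
  \sum_q \sum_q' swap_proj b q q' * ((v q'.1 * v q.1) * (u q'.2 * u q.2)) =
  swap_prob b (\sum_i v i * u i).
Proof.
move=> hv hu.
under eq_bigr => q _ do rewrite swap_proj_apply /=.
rewrite big_pair /=.
transitivity (((\sum_i v i * v i) * (\sum_i u i * u i) +
   (-1) ^+ (~~ b) * ((\sum_i v i * u i) * (\sum_i v i * u i))) / 2).
  rewrite !mulr_suml mulr_sumr -big_split mulr_suml /=; apply: eq_bigr => i _.
  rewrite !mulr_sumr -big_split mulr_suml /=; apply: eq_bigr => j _; ring.
by rewrite hv hu /swap_prob; congr ((_ + _ * _) / _); ring.
Qed.

End SwapTest.

Lemma sum_ffun2 (R : comNzRingType) (k : nat) (D : finType) (F : 'I_k -> D -> D -> R) :
  \sum_(u : {ffun 'I_k -> D}) \sum_(v : {ffun 'I_k -> D}) \prod_i F i (u i) (v i) =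
  \prod_i \sum_a \sum_b F i a b.
Proof.
rewrite [RHS]bigA_distr_bigA; apply: eq_bigr => u _.
by rewrite bigA_distr_bigA.
Qed.

(** It lets a register of [a * k] qubits be read as [k] registers of [a] qubits. *)
Lemma qreg_ffun_bij (a k : nat) :
  exists e : qreg (a * k) -> {ffun 'I_k -> qreg a}, bijective e.
Proof.
have H : (2 ^ (a * k) = #|{ffun 'I_k -> qreg a}|)%N.
  by rewrite card_ffun !card_ord expnM.
exists (fun i => enum_val (cast_ord H i)).
exists (fun u => cast_ord (esym H) (enum_rank u)) => i.
  by rewrite enum_valK cast_ordK.
by rewrite cast_ordKV enum_rankK.
Qed.

(** Cauchy-Schwarz, from the nonnegativity of the squared norms of [v + u] and [v - u]. *)
Lemma dot_sqr_le1 (D : finType) (v u : D -> Rr) :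
  \sum_i v i * v i = 1 -> \sum_i u i * u i = 1 -> (\sum_i v i * u i) ^+ 2 <= 1.
Proof.
move=> hv hu.
have h (s : Rr) : s ^+ 2 = 1 -> 0 <= 2 + 2 * s * \sum_i v i * u i.
  move=> s1; rewrite (_ : _ + _ = \sum_i (v i + s * u i) ^+ 2).
    by apply: sumr_ge0 => i _; apply: sqr_ge0.
  transitivity (\sum_i v i * v i + \sum_i u i * u i + 2 * s * \sum_i v i * u i).
    by rewrite hv hu.
  rewrite mulr_sumr -!big_split; apply: eq_bigr => i _ /=.
  rewrite (_ : (v i + s * u i) ^+ 2 =
    v i * v i + s ^+ 2 * (u i * u i) + 2 * s * (v i * u i)); last by ring.
  by rewrite s1 mul1r.
have h1 := h 1 (expr1n _ _); have h2 : 0 <= 2 + 2 * -1 * \sum_i v i * u i.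
  by apply: h; rewrite sqrrN expr1n.
nra.
Qed.

(** Each party sends [k] copies of its state; the referee accepts when at least a fraction [t] of
    the swap tests is symmetric. The condition [16 <= k e^2] makes the Chernoff error at most
    [expR (- 2)], below 1/3. *)
Lemma swap_tests_smp n (f : inp n -> inp n -> bool) (a k : nat)
    (v u : inp n -> qreg a -> Rr) (t e : Rr) :
  (forall x, \sum_i v x i * v x i = 1) -> (forall y, \sum_i u y i * u y i = 1) ->
  0 <= t <= 1 -> 0 <= e -> 16 <= k%:R * e ^+ 2 ->
  (forall x y, let p := swap_prob true (\sum_i v x i * u y i) in
     (f x y -> t + e <= p) /\ (~~ f x y -> p <= t - e)) ->
  smp_ok f (a * k + a * k).
Proof.
move=> hv hu /andP[t0 t1] e0 hk hp.
have [ee eb] := qreg_ffun_bij a k.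
pose Z (b : bool) : Rr := b%:R - t.
pose Q (s : {ffun 'I_k -> bool}) := 0 <= \sum_i Z (s i).
pose prodv (w : inp n -> qreg a -> Rr) x (i : qreg (a * k)) : Rr :=
  \prod_l w x (ee i l).
pose rho (w : inp n -> qreg a -> Rr) x : op (qreg (a * k)) :=
  fun i i' => (prodv w x i * prodv w x i')%:C%C.
pose T (s : {ffun 'I_k -> bool}) (p p' : qreg (a * k) * qreg (a * k)) : Rr :=
  \prod_l swap_proj (s l) (ee p.1 l, ee p.2 l) (ee p'.1 l, ee p'.2 l).
(* Kept generic in the accepting set: the complement of [M Q] is then [M (predC Q)], so a single
   positivity proof gives both halves of [effect]. *)
pose M Q : op (qreg (a * k) * qreg (a * k))%type :=
  fun p p' => (\sum_(s | Q s) T s p p')%:C%C.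
have sum_e (F : {ffun 'I_k -> qreg a} -> Rr) : \sum_i F (ee i) = \sum_w F w.
  by rewrite [RHS](reindex ee) //; apply: onW_bij.
have dens w : (forall x, \sum_i w x i * w x i = 1) -> forall x, density (rho w x).
  move=> hw x; split.
    apply: (@psd_real_gram _ unit predT (fun _ => prodv w x)) => p p'.
    by rewrite big_const card_unit /= addr0.
  rewrite /trace /rho -rmorph_sum /= /prodv.
  under eq_bigr => i _ do rewrite -big_split /=.
  rewrite (sum_e (fun g => \prod_l (w x (g l) * w x (g l)))).
  rewrite -(bigA_distr_bigA (fun (_ : 'I_k) d => w x d * w x d)) /=.
  by rewrite hw prodr_const expr1n.
have psdM Q' : psd (M Q').
  apply: (@psd_real_gram _ ({ffun 'I_k -> bool} *
     {ffun 'I_k -> (qreg a * qreg a)%type})%type (fun j => Q' j.1)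
     (fun j p => \prod_l swap_proj (j.1 l) (j.2 l) (ee p.1 l, ee p.2 l))) => p p'.
  rewrite /M; congr (_ %:C%C).
  rewrite big_pair_cond /=.
  apply: eq_bigr => s _; rewrite /T.
  under eq_bigr => l _ do rewrite -swap_proj_idem.
  rewrite bigA_distr_bigA; apply: eq_bigr => r _.
  by rewrite big_split.
have MC Q' p p' : @idop _ p p' - M Q' p p' = M (predC Q') p p'.
  rewrite /idop (_ : (p == p')%:R = (\sum_s T s p p')%:C%C); last first.
    rewrite /T -(bigA_distr_bigA (fun l b =>
       swap_proj b (ee p.1 l, ee p.2 l) (ee p'.1 l, ee p'.2 l))) /=.
    under eq_bigr => l _ do rewrite swap_proj_sum.
    rewrite -natr_prod rmorph_nat; congr (_%:R).
    case: eqP => [->|ne]; first by rewrite big1 // => l _; rewrite eqxx.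
    apply/esym/eqP; rewrite -[_ == _]negbK -lt0n; apply/negP => h.
    apply: ne; have {}h l : (ee p.1 l, ee p.2 l) = (ee p'.1 l, ee p'.2 l).
      apply/eqP; move: h; rewrite (bigD1 l) //= muln_gt0 => /andP[].
      by case: eqP.
    case: p p' h => [p1 p2] [p1' p2'] /= h.
    by congr (_, _); apply: (bij_inj eb); apply/ffunP => l; case: (h l).
  rewrite /M (bigID Q') /= rmorphD /= addrC addKr.
  by [].
(* The copies are independent, so each outcome string has a product probability. *)
have acc Q' x y : trace (mulop (M Q') (kron (rho v x) (rho u y))) =
   (\sum_(s | Q' s) \prod_l swap_prob (s l) (\sum_i v x i * u y i))%:C%C.
  rewrite /trace /mulop.
  transitivity ((\sum_p \sum_p' \sum_(s | Q' s) \prod_l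
     (swap_proj (s l) (ee p.1 l, ee p.2 l) (ee p'.1 l, ee p'.2 l) *
     ((v x (ee p'.1 l) * v x (ee p.1 l)) * (u y (ee p'.2 l) * u y (ee p.2 l)))))%:C%C).
    rewrite rmorph_sum; apply: eq_bigr => p _.
    rewrite rmorph_sum; apply: eq_bigr => p' _.
    rewrite /M /kron /rho -!rmorphM mulr_suml; congr (_ %:C%C).
    by apply: eq_bigr => s _; rewrite /prodv /T !big_split.
  congr (_ %:C%C).
  under eq_bigr => p _ do rewrite exchange_big /=.
  rewrite exchange_big /=; apply: eq_bigr => s _.
  pose H l (d1 d2 d3 d4 : qreg a) := swap_proj (s l) (d1, d2) (d3, d4) *
     ((v x d3 * v x d1) * (u y d4 * u y d2)).
  transitivity (\sum_(p1 : {ffun 'I_k -> qreg a}) \sum_(p2 : {ffun 'I_k -> qreg a})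
     \sum_(p3 : {ffun 'I_k -> qreg a}) \sum_(p4 : {ffun 'I_k -> qreg a})
     \prod_l H l (p1 l) (p2 l) (p3 l) (p4 l)).
    rewrite big_pair -sum_e; apply: eq_bigr => p1 _.
    rewrite -sum_e; apply: eq_bigr => p2 _.
    rewrite big_pair -sum_e; apply: eq_bigr => p3 _.
    by rewrite -sum_e; apply: eq_bigr => p4 _.
  transitivity (\sum_(p1 : {ffun 'I_k -> qreg a}) \sum_(p2 : {ffun 'I_k -> qreg a})
     \prod_l \sum_d3 \sum_d4 H l (p1 l) (p2 l) d3 d4).
    apply: eq_bigr => p1 _; apply: eq_bigr => p2 _.
    exact: (sum_ffun2 (fun l => H l (p1 l) (p2 l))).
  rewrite (sum_ffun2 (fun l d1 d2 => \sum_d3 \sum_d4 H l d1 d2 d3 d4)).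
  apply: eq_bigr => l _; rewrite -(swap_proj_prob _ (hv x) (hu y)) [RHS]big_pair.
  by apply: eq_bigr => d1 _; apply: eq_bigr => d2 _; rewrite [RHS]big_pair.
exists (a * k)%N, (a * k)%N, (rho v), (rho u), (M Q).
split => //; split; first exact: dens.
split; first exact: dens.
split.
  split=> // w; rewrite /subop.
  under eq_bigr => i _ do (under eq_bigr => j _ do rewrite MC).
  exact: psdM.
move=> x y; rewrite /= acc.
set ip := \sum_i v x i * u y i.
have ip1 : ip ^+ 2 <= 1 by apply: dot_sqr_le1.
have ip0 : 0 <= ip ^+ 2 by apply: sqr_ge0.
have pr0 b : 0 <= swap_prob b ip.
  by rewrite /swap_prob; case: b; rewrite ?expr0 ?expr1; lra.
have pr1 : \sum_b swap_prob b ip = 1.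
  by rewrite big_bool /swap_prob /= expr0 expr1; field.
have Z1 b : `|Z b| <= 1 by rewrite ler_norml /Z; case: b => /=; apply/andP; split; lra.
have NZ1 b : `|- Z b| <= 1 by rewrite normrN.
have EZ : \sum_b swap_prob b ip * Z b = swap_prob true ip - t.
  by rewrite big_bool /Z /swap_prob /= expr0 expr1; field.
have small : expR (- (k%:R * e ^+ 2 / 8)) <= 1 / 3 :> Rr.
  apply: (@le_trans _ _ (expR (- 2))); first by rewrite ler_expR; lra.
  rewrite expRN div1r lef_pV2 ?posrE ?expR_gt0 //.
  by apply: le_trans (expR_ge1Dx _); lra.
case: (hp x y); rewrite -/ip => h1 h0.
rewrite (real_complex_frac 2 3) (real_complex_frac 1 3) !le_real_complex; split => hf.
  have EN : \sum_b swap_prob b ip * - Z b <= - e.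
    under eq_bigr => b _ do rewrite mulrN.
    by rewrite sumrN EZ; have := h1 hf; lra.
  have := le_trans (chernoff k pr0 pr1 NZ1 e0 EN) small.
  have tot : \sum_(s : {ffun 'I_k -> bool}) \prod_l swap_prob (s l) ip = 1.
    by rewrite -(bigA_distr_bigA (fun (_ : 'I_k) b => swap_prob b ip)) /= pr1 prodr_const expr1n.
  rewrite (bigID Q) /= in tot.
  (* A rejecting string has negative sum of [Z], so it lies in the event bounded for [- Z]. *)
  have : \sum_(s : {ffun 'I_k -> bool} | ~~ Q s) \prod_l swap_prob (s l) ip <=
     \sum_(s : {ffun 'I_k -> bool} | 0 <= \sum_i - Z (s i)) \prod_l swap_prob (s l) ip.
    rewrite big_mkcond [leRHS]big_mkcond; apply: ler_sum => s _ /=.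
    case: (boolP (Q s)) => [_|nQ] /=; first by case: ifP => // _; apply: prodr_ge0.
    by rewrite ifT // sumrN oppr_ge0 ltW // ltNge.
  lra.
have EN : \sum_b swap_prob b ip * Z b <= - e by rewrite EZ; have := h0 hf; lra.
exact: le_trans (chernoff k pr0 pr1 Z1 e0 EN) small.
Qed.

(** * Least costs, fingerprint vectors and the SMP protocol *)

Lemma minnat_le (Q : nat -> Prop) k : Q k -> (minnat Q <= k)%N.
Proof.
move=> Qk; rewrite /minnat; case: pselect => // h.
by case: ex_minnP => m _; apply; apply/asboolP.
Qed.

Lemma minnatP (Q : nat -> Prop) : (exists k, Q k) -> Q (minnat Q).
Proof.
move=> hQ; rewrite /minnat; case: pselect => // h.
by case: ex_minnP => m /asboolP.
Qed.

Lemma dot_abs_le (N : nat) (g h : 'I_N -> Rr) :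
  (forall i, `|g i| <= 1) -> (forall i, `|h i| <= 1) ->
  `|\sum_i g i * h i| <= N%:R.
Proof.
move=> bg bh; apply: le_trans (ler_norm_sum _ _ _) _.
rewrite -[X in X%:R]card_ord -sumr_const; apply: ler_sum => i _.
by rewrite normrM mulr_ile1.
Qed.

(* The four coordinates attached to i are 1, g_i, sqrt(1 - g_i^2), 0 for v and
   1, h_i, 0, sqrt(1 - h_i^2) for u, divided by sqrt(2N): the constant makes the
   inner product nonnegative, so that squaring it preserves the gap. *)
Lemma unit_vectors n (N a : nat) (g h : inp n -> 'I_N -> Rr) :
  (0 < N)%N -> (4 * N <= 2 ^ a)%N ->
  (forall x i, `|g x i| <= 1) -> (forall y i, `|h y i| <= 1) ->
  exists v u : inp n -> qreg a -> Rr,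
    (forall x, \sum_i v x i * v x i = 1) /\ (forall y, \sum_i u y i * u y i = 1) /\
    forall x y, \sum_i v x i * u y i = (1 + (\sum_i g x i * h y i) / N%:R) / 2.
Proof.
move=> N0 hN bg bh; pose s : Rr := (Num.sqrt (2 * N%:R))^-1.
have NR : (0 : Rr) < N%:R by rewrite ltr0n.
have s2 : s * s = (2 * N%:R)^-1.
  by rewrite /s -expr2 exprVn sqr_sqrtr // mulr_ge0 // ltW.
pose v x (d : 'I_N * (bool * bool)) : Rr := s * (if d.2.1
  then if d.2.2 then 1 else g x d.1
  else if d.2.2 then Num.sqrt (1 - g x d.1 ^+ 2) else 0).
pose u y (d : 'I_N * (bool * bool)) : Rr := s * (if d.2.1
  then if d.2.2 then 1 else h y d.1
  else if d.2.2 then 0 else Num.sqrt (1 - h y d.1 ^+ 2)).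
have card_le : (#|{: 'I_N * (bool * bool)}| <= 2 ^ a)%N.
  by rewrite !card_prod card_bool card_ord mulnC.
have sqr1 (z : Rr) : `|z| <= 1 -> Num.sqrt (1 - z ^+ 2) * Num.sqrt (1 - z ^+ 2) = 1 - z ^+ 2.
  move=> hz; rewrite -expr2 sqr_sqrtr // subr_ge0 -real_normK ?num_real //.
  by rewrite expr_le1.
have two (b : Rr) : b = (2 * N%:R)^-1 * (2 * N%:R) -> b = 1.
  by move=> ->; rewrite mulVf // mulf_neq0 // gt_eqF.
exists (fun x => pad (v x)), (fun y => pad (u y)); split.
  move=> x; rewrite pad_dot // big_pair; apply: two.
  rewrite -[N in _ * (2 * N%:R)]card_ord mulrA -sumr_const mulr_sumr; apply: eq_bigr => i _.
  rewrite big_pair !big_bool /v /=.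
  transitivity (s * s * (1 + g x i ^+ 2 + Num.sqrt (1 - g x i ^+ 2) * Num.sqrt (1 - g x i ^+ 2))).
    by ring.
  by rewrite s2 sqr1 //; ring.
split.
  move=> y; rewrite pad_dot // big_pair; apply: two.
  rewrite -[N in _ * (2 * N%:R)]card_ord mulrA -sumr_const mulr_sumr; apply: eq_bigr => i _.
  rewrite big_pair !big_bool /u /=.
  transitivity (s * s * (1 + h y i ^+ 2 + Num.sqrt (1 - h y i ^+ 2) * Num.sqrt (1 - h y i ^+ 2))).
    by ring.
  by rewrite s2 sqr1 //; ring.
move=> x y; rewrite pad_dot // big_pair.
transitivity ((2 * N%:R)^-1 * (N%:R + \sum_i g x i * h y i)); last first.
  by field; apply: lt0r_neq0.
rewrite -[X in X%:R + _]card_ord -sumr_const -big_split mulr_sumr /=.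
apply: eq_bigr => i _; rewrite big_pair !big_bool /u /v /= -s2; ring.
Qed.

(** The register holds the [4 N] fingerprint coordinates: [4 * 96 ^ 2 <= 2 ^ 16],
    [M ^ 2 = 2 ^ (2 + 4 c)] and [n <= 2 ^ up_log 2 n]. The second factor is the number of copies. *)
Lemma pub_ok_smp_ok n (f : inp n -> inp n -> bool) c (M := (2 * 4 ^ c)%N) : (0 < n)%N ->
  pub_ok f c -> smp_ok f (2 * ((18 + 4 * c + up_log 2 n) * (192 * M) ^ 2)).
Proof.
move=> n0 /(pub_ok_sample n0); rewrite -/M => -[g [h [bg [bh hz]]]].
have M0 : (0 < M)%N by rewrite muln_gt0 expn_gt0.
have N0 : (0 < (96 * M) ^ 2 * n)%N by rewrite muln_gt0 n0 expn_gt0 muln_gt0 M0.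
have MR : (0 : Rr) < M%:R by rewrite ltr0n.
have hN : (4 * ((96 * M) ^ 2 * n) <= 2 ^ (18 + 4 * c + up_log 2 n))%N.
  rewrite [X in (_ <= X)%N]expnD mulnA leq_mul ?up_logP //.
  have -> : (4 * (96 * M) ^ 2 = 4 * 96 ^ 2 * M ^ 2)%N by rewrite expnMn mulnA.
  have -> : (M ^ 2 = 2 ^ (2 + 4 * c))%N.
    by rewrite /M -[4%N]/(2 ^ 2)%N -expnM -expnS -expnM; congr (2 ^ _)%N; lia.
  rewrite (_ : (18 + 4 * c = 16 + (2 + 4 * c))%N); last lia.
  rewrite [X in (_ <= X)%N]expnD leq_mul2r -[4%N]/(2 ^ 2)%N -expnMn.
  by rewrite (expnM 2 8 2) leq_exp2r ?orbT.
have [v [u [hv [hu ip]]]] := unit_vectors N0 hN bg bh.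
rewrite mul2n -addnn.
(* The threshold [t] is the swap probability at the midpoint [zt]. In [z] that probability has
   derivative [(1 + z) / 4], at least 1/4 for [z >= 0], so a gap of 1/12 over [M] becomes [e]; with
   [(192 M)^2] copies, [k e^2 = 16]. *)
pose zt : Rr := 1 / 2 / M%:R.
pose e : Rr := 1 / 48 / M%:R.
pose t : Rr := (1 + ((1 + zt) / 2) ^+ 2) / 2.
have iM0 : (0 : Rr) < M%:R^-1 by rewrite invr_gt0.
have iM2 : M%:R^-1 <= (2^-1 : Rr).
  by rewrite lef_pV2 ?posrE // (ler_nat _ 2) leq_pmulr // expn_gt0.
apply: (swap_tests_smp (t := t) (e := e) hv hu).
- by rewrite /t /zt; apply/andP; split; nra.
- by rewrite /e; lra.
- rewrite natrX natrM le_eqVlt; apply/orP; left; apply/eqP.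
  by rewrite /e; field; apply: lt0r_neq0.
move=> x y; rewrite /= /swap_prob ip /= expr0 mul1r.
have := hz x y; set S := \sum_i g x i * h y i; set z := S / _ => hz'.
(* This keeps the inner product nonnegative, where the swap probability increases with [z]. *)
have z1 : -1 <= z.
  have := dot_abs_le (bg x) (bh y); rewrite -/S ler_norml => /andP[h1 _].
  by rewrite /z ler_pdivlMr ?ltr0n // mulN1r.
rewrite /t /e /zt; move: hz' => /= [h1 h0]; split => hf.
  have := h1 hf; nra.
have := h0 hf; nra.
Qed.

(** * Existence of a protocol for every function *)

(** Measure in the standard basis, then prepare [phi t1]: one Kraus operator per basis state makes
    this a channel even when [phi] is not injective. *)
Definition det_kraus (T U : finType) (phi : T -> U) : seq (rop T U) :=
  [seq (fun u t => ((t == t1) && (u == phi t1))%:R) | t1 <- enum T].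

Lemma det_kraus_tp (T U : finType) (phi : T -> U) : kraus_tp (det_kraus phi).
Proof.
move=> t t'; rewrite /det_kraus big_map big_enum /= (bigD1 t) //= [X in _ + X]big1 ?addr0.
  rewrite /mulop /adjop /idop (bigD1 (phi t)) //= !eqxx /= andbT conjC_nat mul1r.
  by rewrite big1 ?addr0 1?eq_sym // => u /negPf->; rewrite andbF mulr0.
move=> t1 /negPf; rewrite eq_sym => ne; rewrite /mulop /adjop big1 // => u _.
by rewrite ne /= conjC_nat mul0r.
Qed.

(** On a basis state only the Kraus pair matching Alice's state and Bob's state with the message
    survives. *)
Lemma joinA_det (n : nat) (P : qprot n) (phi : 'I_(qdA P).+1 -> 'I_(qdA P).+1 * qubit)
    (psi : 'I_(qdB P).+1 * qubit -> 'I_(qdB P).+1) a0 b0 p p' :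
  apply_kraus [seq Defs.joinA K L | K <- det_kraus phi, L <- det_kraus psi]
    (fun p p' => ((p == (a0, b0)) && (p' == (a0, b0)))%:R) p p' =
  let r := ((phi a0).1, psi (b0, (phi a0).2)) in ((p == r) && (p' == r))%:R.
Proof.
have JE a1 t1 q : Defs.joinA (P := P) (fun u t => ((t == a1) && (u == phi a1))%:R)
    (fun u t => ((t == t1) && (u == psi t1))%:R) q (a0, b0) =
    ((a1 == a0) && (t1 == (b0, (phi a0).2)) && (q == ((phi a0).1, psi (b0, (phi a0).2))))%:R.
  rewrite /Defs.joinA /=; case: (eqVneq a0 a1) => [<-|ne] /=; last first.
    by rewrite big1 // => b _; rewrite mulr0.
  case: (phi a0) => c d; case: q => q1 q2 /=.
  rewrite (bigD1 d) //= big1 ?addr0 => [|b /negPf ne]; last first.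
    by rewrite xpair_eqE ne andbF mulr0.
  rewrite eq_sym; case: (eqVneq t1 (b0, d)) => [->|_] /=; last by rewrite mul0r.
  by rewrite !xpair_eqE eqxx andbT -natrM mulnb andbC.
rewrite /apply_kraus big_allpairs_dep /det_kraus big_map big_enum /= (bigD1 a0) //=.
rewrite [X in _ + X]big1 ?addr0 => [|a1 /negPf ne]; last first.
  rewrite big_map big1 // => t1 _; rewrite /mulop big1 // => q _.
  rewrite big1 ?mul0r // => q' _.
  case: (eqVneq q' (a0, b0)) => [->|]; last by rewrite mulr0.
  by rewrite JE ne mul0r.
rewrite big_map big_enum /= (bigD1 (b0, (phi a0).2)) //=.
rewrite [X in _ + X]big1 ?addr0 => [|t1 /negPf ne]; last first.
  rewrite /mulop big1 // => q _.
  rewrite big1 ?mul0r // => q' _.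
  case: (eqVneq q' (a0, b0)) => [->|]; last by rewrite mulr0.
  by rewrite JE ne andbF mul0r.
rewrite /mulop (bigD1 (a0, b0)) //= [X in _ + X]big1 ?addr0 => [|q /negPf ne]; last first.
  by rewrite big1 ?mul0r // => q' _; rewrite ne andbF mulr0.
rewrite (bigD1 (a0, b0)) //= big1 ?addr0 => [|q /negPf ne]; last first.
  by rewrite ne mulr0.
by rewrite /adjop !JE !eqxx /= mulr1 conjC_nat -natrM mulnb.
Qed.

Lemma psd_indicator (T : finType) (Q : pred T) :
  psd (fun b b' : T => ((b == b') && Q b)%:R : Rc).
Proof.
apply: (@psd_real_gram _ _ Q (fun j b => (j == b)%:R)) => p p'.
rewrite big_mkcond (bigD1 p) //= big1 ?addr0 => [|j /negPf->]; last first.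
  by rewrite mul0r if_same.
by rewrite eqxx mul1r andbC; case: (Q p); rewrite //= rmorph_nat.
Qed.

Lemma effect_indicator (T : finType) (Q : pred T) :
  effect (fun b b' : T => ((b == b') && Q b)%:R : Rc).
Proof.
split; first exact: psd_indicator.
rewrite (_ : subop _ _ = fun b b' => ((b == b') && predC Q b)%:R).
  exact: psd_indicator.
apply/funext => b; apply/funext => b'; rewrite /subop /idop /=.
by case: (b == b') (Q b) => [] []; rewrite /= ?subr0 ?subrr.
Qed.

(* Alice enumerates all inputs, flagging her own; Bob records f at the flag. *)
Definition enum_prot (n : nat) (f : inp n -> inp n -> bool) : qprot n :=
  @QProt n 0 1 #|{: inp n}| (fun _ => true)
    (fun t x => det_kraus (fun _ => (ord0, if enum_rank x == t :> nat then ord_max else ord0)))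
    (fun _ _ => det_kraus fst)
    (fun _ _ => det_kraus (fun b => (b, ord0)))
    (fun t y => det_kraus (fun bq => if bq.2 == ord0 then bq.1
       else if [exists x, (enum_rank x == t :> nat) && f x y] then ord_max else ord0))
    false (fun _ => @idop _) (fun _ b b' => ((b == b') && (b == ord_max))%:R).

Lemma enum_prot_valid n (f : inp n -> inp n -> bool) : qvalid (enum_prot f).
Proof.
do 4!(split; first by move=> *; apply: det_kraus_tp).
split=> *; first exact: effect_id.
exact: (effect_indicator (fun b => b == ord_max)).
Qed.

(** The flag is raised only in round [enum_rank x]; every other round leaves Bob's bit unchanged. *)
Lemma enum_prot_state n (f : inp n -> inp n -> bool) x y t :
  @qstate _ (enum_prot f) x y t = fun p p' =>
    let r := (ord0, if (enum_rank x < t)%N && f x y then ord_max else ord0) in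
    ((p == r) && (p' == r))%:R.
Proof.
elim: t => [|t IH]; apply/funext => p; apply/funext => p' //.
rewrite -[LHS]/(apply_kraus (@round_kraus _ (enum_prot f) x y t)
  (@qstate _ (enum_prot f) x y t) p p') IH.
etransitivity; first exact: (@joinA_det _ (enum_prot f)).
cbv zeta; set b := (X in (_, X)); set b' := (X in _ = ((p == (_, X)) && _)%:R).
suff -> : b = b' by [].
rewrite {}/b {}/b' /= [in RHS]ltnS [in RHS]leq_eqVlt.
case: (eqVneq (enum_rank x : nat) t) => [E|_] //=.
rewrite (_ : [exists _, _] = f x y) //; apply/existsP/idP => [[x' /andP[]]|h].
  by rewrite -E => /eqP/val_inj/enum_rank_inj->.
by exists x; rewrite E eqxx.
Qed.

Lemma enum_prot_accept n (f : inp n -> inp n -> bool) x y :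
  qaccept (enum_prot f) x y = (f x y)%:R.
Proof.
rewrite /qaccept enum_prot_state ltn_ord /= /trace /mulop.
set r := (ord0, _); rewrite (bigD1 r) //= [X in _ + X]big1 ?addr0; last first.
  by move=> p /negPf ne; rewrite big1 // => q _; rewrite ne andbF mulr0.
rewrite (bigD1 r) //= big1 ?addr0 => [|q /negPf ne]; last by rewrite ne mulr0.
rewrite /kron /idop /= !eqxx /= mulr1 mul1r.
by case: (f x y).
Qed.

(** It ensures that [Qpub f] is the cost of an actual protocol and not the default 0 of [minnat]. *)
Lemma pub_ok_exists n (f : inp n -> inp n -> bool) : exists c, pub_ok f c.
Proof.
exists #|{: inp n}|, 1%N, (fun _ => 1), (fun _ => enum_prot f).
split=> //; split; first by rewrite big_ord1.
split; first by move=> _; split => //; apply: enum_prot_valid.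
move=> x y; rewrite /= big_ord1 mul1r enum_prot_accept.
rewrite (real_complex_frac 2 3) (real_complex_frac 1 3).
rewrite -(rmorph_nat (real_complex Rr)) !le_real_complex.
by case: (f x y) => /=; split => // _; lra.
Qed.

(** * Logarithm estimates and the final bound *)

Lemma ln2_ge_half (R : realType) : 1 / 2 <= ln 2 :> R.
Proof.
rewrite -(expRK (1 / 2)) ler_ln ?posrE ?expR_gt0 //.
rewrite -[leLHS]invrK -expRN -[leRHS]invrK lef_pV2 ?posrE ?invr_gt0 ?expR_gt0 //.
by apply: le_trans (expR_ge1Dx _); lra.
Qed.

(** [2 ^ (up_log 2 n - 1) < n] and [ln 2 >= 1/2] bound [up_log 2 n - 1] by [2 ln n]; the remaining 1
    is also at most [2 ln n]. *)
Lemma up_log2_le_ln (R : realType) n : (2 <= n)%N ->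
  (up_log 2 n)%:R <= 4 * ln (n%:R : R).
Proof.
move=> n2; have ln2 := ln2_ge_half R.
have n0 : (0 : R) < n%:R by rewrite ltr0n (leq_trans _ n2).
have hn : ln 2 <= ln (n%:R : R) by rewrite ler_ln ?posrE // (ler_nat _ 2).
have /andP[lo _] := up_log_bounds (isT : (1 < 2)%N) n2.
have : (up_log 2 n).-1%:R * ln 2 <= ln (n%:R : R).
  rewrite mulr_natl -lnXn // ler_ln ?posrE ?exprn_gt0 //.
  by rewrite -natrX ler_nat ltnW.
have -> : (up_log 2 n)%:R = (up_log 2 n).-1%:R + 1 :> R.
  by rewrite natr1 prednK // up_log_gt0.
move=> hu; have := ler_wpM2l (ler0n R (up_log 2 n).-1) ln2.
lra.
Qed.

Theorem mainTheorem1 :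
  exists C : Rr, 0 < C /\
    forall (n : nat), (2 <= n)%N ->
    forall f : inp n -> inp n -> bool,
      (Qsmp f)%:R <= C * 2 ^+ (8 * Qpub f) * ln (n%:R : Rr).
Proof.
(* The factor 2 counts the two messages, [192 ^+ 2 * 4] comes from [(192 M)^2 = 192^2 * 4 * 16^c],
   and 48 from the register size bound [key]. *)
exists (2 * 192 ^+ 2 * 4 * 48); split=> [|n n2 f].
  by rewrite !mulr_gt0 ?exprn_gt0.
have n0 : (0 < n)%N by apply: leq_trans n2.
have := minnatP (pub_ok_exists f); rewrite -/(Qpub f).
move: (Qpub f) => c /(pub_ok_smp_ok n0) /minnat_le; rewrite -/(Qsmp f).
rewrite -(ler_nat Rr) => /le_trans; apply.
rewrite !(natrM, natrD, natrX).
set L : Rr := (up_log 2 n)%:R.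
have L0 : 0 <= L by [].
have hL : L <= 4 * ln n%:R by apply: up_log2_le_ln.
have hl : 1 / 2 <= ln (n%:R : Rr).
  apply: le_trans (ln2_ge_half _) _.
  by rewrite ler_ln ?posrE ?ltr0n // (ler_nat _ 2).
have -> : 2 ^+ (8 * c) = (16 ^+ c) ^+ 2 :> Rr.
  by rewrite exprM [RHS]exprAC; congr (_ ^+ c); ring.
rewrite (exprMn _ 192).
have -> : (2 * 4 ^+ c) ^+ 2 = 4 * 16 ^+ c :> Rr.
  by rewrite exprMn (exprAC _ c 2); congr (_ * _ ^+ c); ring.
(* The term linear in [c] is absorbed by a second factor [16 ^+ c], which brings the total to
   [2 ^+ (8 * c)]. *)
have c16 : (1 + c%:R : Rr) <= 16 ^+ c.
  by rewrite addrC natr1 -natrX ler_nat ltn_expl.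
move: c16; move: (16 ^+ c : Rr) => X hX.
have c0 : 0 <= c%:R :> Rr by [].
have key : 18 + 4 * c%:R + L <= 48 * ln n%:R * X by nra.
have X0 : 0 <= X by nra.
have := ler_wpM2l X0 key; nra.
Qed.
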